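(* Let $d\ge 2$ be a fixed integer and let $D$ be a $d$-ary tree with at least two leaves. Then $$\max_{|T|=n,\ T\ d\text{-ary}}\gamma(D,T)=I_d(D)+\mathcal{O}(n^{-1})$$ for all $n\ge |D|$, i.e. there is a constant $K=K(d,D)$ such that the two sides differ by at most $K/n$ for all integers $n\ge |D|$. In particular, $$\lim_{n\to\infty}\ \max_{|T|=n,\ T\ d\text{-ary}}\gamma(D,T)=I_d(D),$$ and this is the limit of a decreasing (i.e. non-increasing) sequence indexed by $n\ge |D|$.
   Context: All trees are finite and rooted, with unordered children; isomorphism means isomorphism of rooted trees. The single vertex is regarded as a tree whose only vertex is both root and leaf. For a rooted tree $T$, $|T|$ denotes its number of leaves. For an integer $d\ge 2$, a $d$-ary tree is a rooted tree in which every non-leaf vertex has between $2$ and $d$ children. For a nonempty set $S$ of leaves of $T$, the subtree of $T$ induced by $S$ is obtained by taking the minimal subtree of $T$ containing the leaves in $S$, rooting it at the most recent common ancestor of $S$, and suppressing (contracting) all non-root vertices of degree $2$. Let $c(D,T)$ be the number of sets of $|D|$ leaves of $T$ whose induced subtree is isomorphic to $D$, and for $|T|\ge |D|$ let $\gamma(D,T)=c(D,T)/\binom{|T|}{|D|}$. The inducibility of a $d$-ary tree $D$ in $d$-ary trees is $$I_d(D)=\limsup_{n\to\infty}\ \max_{|T|=n,\ T\ d\text{-ary}}\gamma(D,T).$$ *)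

(* Defs.v *)
From mathcomp Require Import all_boot all_order all_algebra.
From mathcomp Require Import boolp classical_sets reals topology normedtype sequences.
Import Order.TTheory GRing.Theory Num.Theory.
Import numFieldNormedType.Exports.

Set Implicit Arguments.
Unset Strict Implicit.
Unset Printing Implicit Defensive.

Local Open Scope classical_set_scope.
Local Open Scope ring_scope.

(** Finite rooted trees. The order of the children is an artefact of the
    encoding: every use below is invariant under [tree_iso]. *)
Inductive tree : Type := Node of seq tree.

Definition children (T : tree) : seq tree := let: Node ts := T in ts.

(** A vertex is named by its address, the sequence of child positions on the
    path that leads to it from the root; the root is [[::]]. *)
Definition address : Type := seq nat.

Definition branches (ss : seq (seq address)) : seq address :=
  flatten [seq [seq ips.1 :: p | p <- ips.2] | ips <- zip (iota 0 (size ss)) ss].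

Fixpoint vertices (T : tree) : seq address :=
  let: Node ts := T in [::] :: branches [seq vertices t | t <- ts].

Fixpoint leaves (T : tree) : seq address :=
  let: Node ts := T in
  if nilp ts then [:: [::]] else branches [seq leaves t | t <- ts].

Definition vertex (T : tree) : finType := seq_sub (vertices T).
Definition leaf (T : tree) : finType := seq_sub (leaves T).

Definition nleaves (T : tree) : nat := size (leaves T).

Definition is_parent (T : tree) (u v : vertex T) : Prop :=
  exists i : nat, val v = rcons (val u) i.

Definition is_root (T : tree) (u : vertex T) : Prop := val u = [::].

Definition tree_iso (T T' : tree) : Prop :=
  exists f : vertex T -> vertex T',
    [/\ bijective f,
        forall u, is_root u <-> is_root (f u)
      & forall u v, is_parent u v <-> is_parent (f u) (f v)].

Fixpoint dary (d : nat) (T : tree) : bool :=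
  let: Node ts := T in
  (nilp ts || (2 <= size ts <= d)%N) && all (dary d) ts.

(** [span S T] keeps the vertices of [T] that are the root or an ancestor (in
    the wide sense) of a leaf with address in [S]. The address of a leaf below
    the [i]-th child is [i :: p], hence the shift of [S] in recursive calls. *)
Definition span_children (span : pred address -> tree -> tree) :=
  fix go (S : pred address) (i : nat) (ts : seq tree) : seq tree :=
    if ts is t :: ts' then
      let St : pred address := fun p => S (i :: p) in
      if has St (leaves t) then span St t :: go S i.+1 ts' else go S i.+1 ts'
    else [::].

Fixpoint span (S : pred address) (T : tree) : tree :=
  let: Node ts := T in Node (span_children span S 0 ts).

(** In a tree all of whose leaves lie in [S], the most recent common ancestor
    of [S] is the first vertex, starting from the root, without exactly one
    child. *)
Fixpoint root_at_mrca (T : tree) : tree :=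
  let: Node ts := T in if ts is [:: t] then root_at_mrca t else T.

(** A non-root vertex has degree 2 exactly when it has exactly one child.
    [contract_unary] also contracts the top vertex of its argument; [suppress]
    applies it below the root only. *)
Fixpoint contract_unary (T : tree) : tree :=
  let: Node ts := T in
  if ts is [:: t] then contract_unary t
  else Node [seq contract_unary t | t <- ts].

Definition suppress (T : tree) : tree :=
  Node [seq contract_unary t | t <- children T].

(** Only meaningful for nonempty [S]. *)
Definition induced (T : tree) (S : {set leaf T}) : tree :=
  suppress (root_at_mrca (span (mem [seq val x | x in S]) T)).

Definition copies (D T : tree) : nat :=
  #|[pred S : {set leaf T} |
      (#|S| == nleaves D) && `[< tree_iso (induced S) D >]]|.

(** Equal to 0 when [nleaves T < nleaves D], as [x / 0 = 0]; this affects only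
    finitely many terms of the upper limit below. *)
Definition density (R : realType) (D T : tree) : R :=
  (copies D T)%:R / 'C(nleaves T, nleaves D)%:R.

(** The supremum is attained: see [max_density_attained]. *)
Definition max_density (R : realType) (d : nat) (D : tree) (n : nat) : R :=
  sup [set density R D T | T in [set T | dary d T /\ nleaves T = n]].

Definition inducibility (R : realType) (d : nat) (D : tree) : R :=
  limn_sup (max_density R d D).

Fixpoint caterpillar (n : nat) : tree :=
  if n is n'.+1 then Node [:: caterpillar n'; Node [::]] else Node [::].

Lemma dary_caterpillar d n : (2 <= d)%N -> dary d (caterpillar n).
Proof. by move=> d2; elim: n => [|n IH] //=; rewrite d2 IH. Qed.

Lemma nleaves_caterpillar n : nleaves (caterpillar n) = n.+1.
Proof.
elim: n => [|n IH] //.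
by rewrite /nleaves /= /branches /= !size_cat !size_map /= -/(nleaves _) IH addn1.
Qed.

Lemma copies_le D T : (copies D T <= 2 ^ nleaves T)%N.
Proof.
apply: (leq_trans (max_card _)).
rewrite -cardsT -powersetT card_powerset cardsT leq_exp2l //.
rewrite cardE -(size_map val); apply: uniq_leq_size.
  by rewrite (map_inj_uniq val_inj) enum_uniq.
by move=> p /mapP[x _ ->]; exact: valP.
Qed.

Lemma max_density_attained (R : realType) (d : nat) (D : tree) (n : nat) :
  (2 <= d)%N -> (1 <= n)%N ->
  exists2 T : tree, dary d T /\ nleaves T = n &
    density R D T = max_density R d D n /\
    forall T', dary d T' -> nleaves T' = n -> density R D T' <= density R D T.
Proof.
move=> d2; case: n => // n _.
pose P j := `[< exists T, [/\ dary d T, nleaves T = n.+1 & copies D T = j] >].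
have exP : exists j, P j.
  exists (copies D (caterpillar n)); apply/asboolP; exists (caterpillar n).
  by rewrite dary_caterpillar // nleaves_caterpillar.
have ubP j : P j -> (j <= 2 ^ n.+1)%N.
  by move=> /asboolP[T [_ <- <-]]; exact: copies_le.
case: (ex_maxnP exP ubP) => _ /asboolP[T [dT nT <-]] maxT.
have ub T' : dary d T' -> nleaves T' = n.+1 -> density R D T' <= density R D T.
  move=> dT' nT'; rewrite /density nT nT' ler_wpM2r ?invr_ge0 ?ler0n //.
  by rewrite ler_nat maxT //; apply/asboolP; exists T'.
exists T => //; split=> //; apply/eqP; rewrite eq_le; apply/andP; split.
  apply: ub_le_sup; last by exists T.
  by exists (density R D T) => _ [T' [dT' nT'] <-]; exact: ub.
apply: ge_sup; first by exists (density R D T), T.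
by move=> _ [T' [dT' nT'] <-]; exact: ub.
Qed.

(* Main.v *)
(** Write [k = |D|] and [M n] for the maximal density.

    - Averaging over the [n + 1] trees obtained from an optimal tree by deleting
      one leaf shows [M (n + 1) <= M n] for [n >= k].
    - Replace every leaf of [T] by a cherry to get [T2]. Choosing one leaf from
      each cherry embeds [T] into [T2] in [2 ^ n] ways, and a given [k]-set of
      leaves of [T2] lies in the image of at most [2 ^ (n - k)] of them, so
      [c(D, T2) >= 2 ^ k * c(D, T)]. Iterating [j] times,
      [M (2 ^ j * n) >= M n * n (n - 1) ... (n - k + 1) / n ^ k
      >= M n - k ^ 2 / n], and [j -> oo] bounds the limit from below. *)
Require Import Defs.
From mathcomp Require Import all_boot all_order all_algebra.
From mathcomp Require Import zify ring lra.
From mathcomp Require Import boolp classical_sets reals topology normedtype sequences.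
Import Order.TTheory GRing.Theory Num.Theory.
Import numFieldNormedType.Exports.

(** * Restriction of trees along bit masks *)

(** The hypothesis on the children takes the form of a list induction scheme, so a proof only has to
    choose the predicate [Q] on lists of trees and check its two cases. *)
Lemma tree_nested_ind (P : tree -> Prop) :
  (forall ts, (forall Q : seq tree -> Prop, Q [::] ->
     (forall t ts', P t -> Q ts' -> Q (t :: ts')) -> Q ts) -> P (Node ts)) ->
  forall T, P T.
Proof.
move=> IH; fix rec 1 => -[ts]; apply: IH => Q Q0 Qc.
by elim: ts => [|t ts' IHts] //; apply: Qc.
Qed.

(** The start index is free because induction on the list of children shifts it; [branches] is the
    case [i = 0]. *)
Definition branches_from (i : nat) (ss : seq (seq address)) : seq address :=
  flatten [seq [seq ips.1 :: p | p <- ips.2] | ips <- zip (iota i (size ss)) ss].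

Lemma size_branches_from (i : nat) (ss : seq (seq address)) :
  size (branches_from i ss) = sumn (map size ss).
Proof.
rewrite /branches_from.
by elim: ss i => //= s ss IH i; rewrite size_cat size_map IH.
Qed.

Lemma nleaves_Node (ts : seq tree) :
  ~~ nilp ts -> nleaves (Node ts) = sumn (map nleaves ts).
Proof.
by rewrite /nleaves /= => /negPf->; rewrite [LHS]size_branches_from -map_comp.
Qed.

(** Suppression is built in: a lone surviving child takes the place of its parent. *)
Definition join_trees (ts : seq tree) : option tree :=
  match ts with [::] => None | [:: t] => Some t | _ => Some (Node ts) end.

(** A set of leaves is encoded as a bit mask along the list [leaves T];
    [restr m T] is then the induced subtree, without reference to addresses. *)
Fixpoint restr (m : bitseq) (T : tree) : option tree :=
  let: Node ts := T in
  if nilp ts then (if head false m then Some T else None) else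
  join_trees ((fix go (m : bitseq) (ts : seq tree) : seq tree :=
    if ts is t :: ts' then
      seq_of_opt (restr (take (nleaves t) m) t) ++ go (drop (nleaves t) m) ts'
    else [::]) m ts).

(** A named copy of the local fixpoint of [restr], convertible to it, so that lists of children can
    be reasoned about. *)
Fixpoint restrs (m : bitseq) (ts : seq tree) : seq tree :=
  if ts is t :: ts' then
    seq_of_opt (restr (take (nleaves t) m) t) ++ restrs (drop (nleaves t) m) ts'
  else [::].

Lemma restr_Node (m : bitseq) (ts : seq tree) :
  ~~ nilp ts -> restr m (Node ts) = join_trees (restrs m ts).
Proof.
by move=> /= /negPf->.
Qed.

Lemma nleaves_join (ts : seq tree) T :
  join_trees ts = Some T -> nleaves T = sumn (map nleaves ts).
Proof.
case: ts => [|t [|t' ts]] //= [<-]; first by rewrite addn0.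
by rewrite nleaves_Node.
Qed.

Lemma restr_joinE (ts : seq tree) (m : bitseq) :
  size m = sumn (map nleaves ts) ->
  obind (restr m) (join_trees ts) = join_trees (restrs m ts).
Proof.
case: ts => [|t [|t' ts]]; [by []| |by move=> _; exact: restr_Node].
rewrite /= addn0 => <-; rewrite take_size cats0.
by case: (restr m t).
Qed.

(** Through [seq_of_opt] an absent tree counts as zero leaves, so [None] forces a mask without true
    entries. *)
Lemma nleaves_restr (T : tree) (m : bitseq) : size m = nleaves T ->
  sumn (map nleaves (seq_of_opt (restr m T))) = count id m.
Proof.
elim/tree_nested_ind: T m => ts IH m.
case nts: (nilp ts).
  move/nilP: nts ->; rewrite /nleaves /=.
  by case: m => [|[] [|]].
rewrite nleaves_Node ?nts // restr_Node ?nts //.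
have restrsE : forall m, size m = sumn (map nleaves ts) ->
    sumn (map nleaves (restrs m ts)) = count id m.
  pose Q ts := forall m, size m = sumn (map nleaves ts) ->
    sumn (map nleaves (restrs m ts)) = count id m.
  apply: (IH Q) => [[]//|t us IHt IHus m' /= szm].
  rewrite map_cat sumn_cat IHt ?IHus.
  - by rewrite -count_cat cat_take_drop.
  - by rewrite size_drop szm addKn.
  - by rewrite size_takel // szm leq_addr.
move=> /restrsE <-.
case: (restrs m ts) => [|u [|u' us]] //.
by rewrite /join_trees /= nleaves_Node //= addn0.
Qed.

Lemma all2_implb_split (n : nat) (m m' : bitseq) : all2 implb m m' ->
  all2 implb (take n m) (take n m') && all2 implb (drop n m) (drop n m').
Proof.
elim: n m m' => [|n IH] [|b m] [|b' m'] //=.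
by move=> /andP[-> /IH].
Qed.

(** Inducing in two stages: [mask m' m] rewrites [m] along the leaves that [m'] keeps. Masks split
    into blocks, one per child, and the claim is proved block by block. *)
Lemma restr_comp (T : tree) (m m' : bitseq) :
  size m' = nleaves T -> all2 implb m m' ->
  obind (restr (mask m' m)) (restr m' T) = restr m T.
Proof.
elim/tree_nested_ind: T m m' => ts IH m m'.
case nts: (nilp ts).
  move/nilP: nts ->; rewrite /nleaves /=.
  by case: m' => [|[] [|]] //; case: m => [|[] [|]].
rewrite nleaves_Node ?nts // !restr_Node ?nts //.
pose Q ts := forall m m', size m' = sumn (map nleaves ts) -> all2 implb m m' ->
   restrs (mask m' m) (restrs m' ts) = restrs m ts.
have restrsE : Q ts.
  apply: (IH Q); rewrite {}/Q => // t us IHt IHus {}m {}m' /= szm mm'.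
  have [mm1 mm2] := andP (all2_implb_split (nleaves t) _ _ mm').
  have sz1 : size (take (nleaves t) m') = nleaves t.
    by rewrite size_takel // szm leq_addr.
  have sz2 : size (drop (nleaves t) m') = sumn (map nleaves us).
    by rewrite size_drop szm addKn.
  rewrite -(IHt _ _ sz1 mm1) -(IHus _ _ sz2 mm2).
  have szmm : size m = size m' by move: mm'; rewrite all2E => /andP[/eqP].
  rewrite -{1}(cat_take_drop (nleaves t) m') -{1}(cat_take_drop (nleaves t) m).
  rewrite mask_cat; last by rewrite !size_take szmm.
  set a := mask _ _; set b := mask _ _.
  have sza : size a = count id (take (nleaves t) m').
    by rewrite size_mask // !size_take szmm.
  (* If the first child vanishes, [a] is empty and only [b] remains; otherwise [a] is as long as the
     restricted child has leaves, so [take] and [drop] cut exactly between [a] and [b]. *)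
  have := nleaves_restr _ _ sz1.
  case: (restr _ t) => [t'|] /=; last first.
    by rewrite -sza => /esym/eqP/nilP ->.
  by rewrite addn0 -sza => ->; rewrite take_size_cat // drop_size_cat.
move=> szm mm'; rewrite restr_joinE ?restrsE //.
rewrite size_mask; last by move: mm'; rewrite all2E => /andP[/eqP].
have := nleaves_restr (Node ts) m'; rewrite nleaves_Node ?nts // restr_Node ?nts //.
move/(_ szm) <-; case E: (join_trees _) => [u|] /=.
  by rewrite addn0 (nleaves_join _ _ E).
by case: (restrs m' ts) E => [|? []].
Qed.

(** Restriction never adds children, and [join_trees] leaves no vertex with a single child. *)
Lemma dary_restr (d : nat) (T T' : tree) (m : bitseq) :
  dary d T -> restr m T = Some T' -> dary d T'.
Proof.
elim/tree_nested_ind: T m T' => ts IH m T'.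
case nts: (nilp ts).
  by move/nilP: nts => -> _ /=; case: ifP => // _ [<-].
rewrite restr_Node ?nts //= nts /= => /andP[/andP[_ szd] alld].
pose Q ts := forall m, all (dary d) ts ->
  all (dary d) (restrs m ts) && (size (restrs m ts) <= size ts).
have: Q ts.
  apply: (IH Q); rewrite {}/Q => // t us IHt IHus {}m /= /andP[dt /IHus].
  move/(_ (drop (nleaves t) m)) => /andP[du szu].
  rewrite all_cat size_cat du andbT /=.
  case E: (restr _ t) => [t'|] /=; last exact: leqW.
  by rewrite (IHt _ _ dt E) /= add1n ltnS.
move/(_ m alld); case: (restrs m ts) => [|u [|u' us]] //=.
  by rewrite andbT => /andP[du _] [<-].
by move=> /andP[du szu] [<-] /=; rewrite du andbT (leq_trans szu).
Qed.

(** * Agreement of mask restriction with induced subtrees *)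

Lemma has_branches_from (S : pred address) (i : nat) (ts : seq tree) :
  has S (branches_from i (map leaves ts)) = ~~ nilp (span_children Defs.span S i ts).
Proof.
elim: ts i => //= t ts IH i; rewrite /branches_from /= has_cat has_map.
by rewrite [X in _ || X]IH; case: ifP => // hS; apply/orP; left.
Qed.

Lemma restr_leaves (T : tree) (S : pred address) :
  restr (map S (leaves T)) T =
  if has S (leaves T) then Some (contract_unary (Defs.span S T)) else None.
Proof.
elim/tree_nested_ind: T S => ts IH S.
case nts: (nilp ts); first by move/nilP: nts => -> /=; case: (S [::]).
pose Q ts := forall i, restrs (map S (branches_from i (map leaves ts))) ts =
  map contract_unary (span_children Defs.span S i ts).
have restrsE : Q ts.
  apply: (IH Q); rewrite {}/Q => // t us IHt IHus i.
  rewrite /branches_from /= map_cat -/(branches_from _ (map leaves us)) -map_comp.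
  rewrite take_size_cat ?size_map // drop_size_cat ?size_map // IHus.
  by rewrite [restr _ t](IHt (fun p => S (i :: p))); case: ifP.
rewrite restr_Node ?nts //= nts restrsE has_branches_from.
by case: (span_children _ _ _ _) => [|x [|y l]].
Qed.

(** Rerooting at the most recent common ancestor strips exactly the chain of unary vertices at the
    top that [contract_unary] contracts. *)
Lemma suppress_root_at_mrca (T : tree) :
  suppress (root_at_mrca T) = contract_unary T.
Proof.
elim/tree_nested_ind: T => ts IH.
case: ts IH => [|t [|t' ts]] //= IH.
pose Q ts := if ts is t :: _ then
  suppress (root_at_mrca t) = contract_unary t else True.
exact: (IH Q).
Qed.

Lemma uniq_leaves (T : tree) : uniq (leaves T).
Proof.
elim/tree_nested_ind: T => ts IH /=; case: ifP => // _.
(* The lower bound on first entries separates the leaves of one child from those of later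
   children. *)
pose Q ts := forall i, uniq (branches_from i (map leaves ts)) &&
  all (fun p => i <= head 0 p) (branches_from i (map leaves ts)).
have: Q ts; last by move=> /(_ 0)/andP[].
apply: (IH Q); rewrite {}/Q => // t us IHt IHus i.
rewrite /branches_from /= -/(branches_from _ (map leaves us)) cat_uniq all_cat.
move: (IHus i.+1) => /andP[-> /allP IHh].
rewrite map_inj_uniq ?IHt ?andbT //=; last by move=> ? ? [].
apply/and3P; split.
- apply/hasPn => p /IHh ip; apply/negP => /mapP[q _ pE].
  by rewrite pE /= ltnn in ip.
- by apply/allP => _ /mapP[q _ ->] /=.
- by apply/allP => p /IHh /= /ltnW.
Qed.

(** * Counting copies by masks *)

Fixpoint masks (n : nat) : seq bitseq :=
  if n is n'.+1 then map (cons false) (masks n') ++ map (cons true) (masks n')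
  else [:: [::]].

Lemma size_masks n : size (masks n) = 2 ^ n.
Proof. by elim: n => //= n IH; rewrite size_cat !size_map IH addnn expnS mul2n. Qed.

Lemma mem_masks n m : (m \in masks n) = (size m == n).
Proof.
elim: n m => [|n IH] [|b m] //=; rewrite mem_cat.
  by apply/negP => /orP[] /mapP[].
have consI c : injective (cons c : bitseq -> bitseq) by move=> ? ? [].
case: b; rewrite (mem_map (consI _)) IH ?orbF eqSS.
  by case: mapP => // -[].
by case: mapP => [[]|]; rewrite ?orbF.
Qed.

Lemma uniq_masks n : uniq (masks n).
Proof.
elim: n => //= n IH.
have consI c : injective (cons c : bitseq -> bitseq) by move=> ? ? [].
rewrite cat_uniq !(map_inj_uniq (consI _)) IH.
by rewrite andbT; apply/hasPn => _ /mapP[p _ ->]; apply/mapP => -[].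
Qed.

(** For masks of length [nleaves T], the default [Node [::]] occurs only when no leaf is selected,
    which the first conjunct rules out when [D] has a leaf. *)
Definition copy_mask (D T : tree) : pred bitseq := fun m =>
  (count id m == nleaves D) &&
  `[< tree_iso (odflt (Node [::]) (restr m T)) D >].

Lemma card_leaf (T : tree) : #|leaf T| = nleaves T.
Proof. by rewrite card_seq_sub // uniq_leaves. Qed.

Lemma copies_masks (D T : tree) : 0 < nleaves D ->
  copies D T = count (copy_mask D T) (masks (nleaves T)).
Proof.
move=> D0.
(* [phi] sends a set of leaves to its characteristic mask. It is injective, and since there are
   equally many sets and masks it reaches every mask. *)
pose phi (S : {set leaf T}) : bitseq := map (mem [seq val x | x in S]) (leaves T).
have leafE : perm_eq (leaves T) [seq val x | x : leaf T].
  apply: uniq_perm; rewrite ?uniq_leaves ?(map_inj_uniq val_inj) ?enum_uniq //.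
  move=> p; apply/idP/mapP => [pT|[x _ ->]]; last exact: valP.
  by exists (Sub p pT : leaf T); rewrite ?mem_enum.
have count_phi S : count id (phi S) = #|S|.
  rewrite /phi count_map (permP leafE) count_map.
  rewrite cardE [in RHS]/enum_mem size_filter -enumT.
  by apply: eq_count => x; rewrite /= (mem_map val_inj) mem_enum.
have phi_inj : injective phi.
  move=> A B /eq_in_map AB; apply/setP => x.
  by have := AB _ (valP x); rewrite /= !(mem_map val_inj) !mem_enum.
have phiE : perm_eq (map phi (enum {set leaf T})) (masks (nleaves T)).
  apply: uniq_perm; rewrite ?uniq_masks ?(map_inj_uniq phi_inj) ?enum_uniq //.
  apply: (uniq_min_size _ _ _).2; rewrite ?(map_inj_uniq phi_inj) ?enum_uniq //.
    by move=> _ /mapP[S _ ->]; rewrite mem_masks size_map.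
  rewrite size_masks size_map -cardE -cardsT -powersetT card_powerset.
  by rewrite cardsT card_leaf.
rewrite /copies -(permP phiE) count_map -size_filter cardE enumT.
rewrite [in LHS]/enum_mem; congr size; apply: eq_filter => S.
transitivity ((#|S| == nleaves D) && `[< tree_iso (induced S) D >]) => //.
rewrite [RHS]/= /copy_mask count_phi; case: eqP => // cS.
rewrite restr_leaves /induced suppress_root_at_mrca.
case: ifPn => // /hasPn hS; suff : #|S| = 0 by rewrite cS => D00; rewrite D00 in D0.
apply: eq_card0 => x; apply/negbTE.
by have := hS _ (valP x); rewrite /= (mem_map val_inj) mem_enum.
Qed.

(** * Masks below a given mask *)

(** Inverse of [mask m'] on the masks below [m']: the entries of [m] are spread over the true
    positions of [m']. *)
Fixpoint unmask (m' m : bitseq) : bitseq :=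
  if m' is b :: a then
    if b then head false m :: unmask a (behead m) else false :: unmask a m
  else [::].

Lemma size_unmask (m' m : bitseq) : size (unmask m' m) = size m'.
Proof. by elim: m' m => [|[] m' IH] m //=; rewrite IH. Qed.

Lemma unmask_implb (m' m : bitseq) : all2 implb (unmask m' m) m'.
Proof. by elim: m' m => [|[] m' IH] m //=; rewrite IH // implybT. Qed.

Lemma unmaskK (m' m : bitseq) : size m = count id m' -> mask m' (unmask m' m) = m.
Proof.
by elim: m' m => [|[] m' IH] [|b m] //= [sz]; rewrite IH //= sz.
Qed.

Lemma maskK_implb (m' m : bitseq) : all2 implb m m' -> unmask m' (mask m' m) = m.
Proof. by elim: m' m => [|[] m' IH] [|[] m] //= mm; rewrite IH. Qed.

Lemma count_mask_implb (m' m : bitseq) :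
  all2 implb m m' -> count id (mask m' m) = count id m.
Proof. by elim: m' m => [|[] m' IH] [|[] m] //= mm; rewrite IH. Qed.

Lemma nleaves_restr_Some (T T' : tree) (m : bitseq) :
  size m = nleaves T -> restr m T = Some T' -> nleaves T' = count id m.
Proof. by move=> /nleaves_restr <- -> /=; rewrite addn0. Qed.

(** [mask m'] is a bijection from the masks below [m'] to the masks of [T'], and [restr_comp] shows
    that it preserves the induced tree. *)
Lemma count_copy_mask_restr (D T T' : tree) (m' : bitseq) :
  size m' = nleaves T -> restr m' T = Some T' ->
  count (fun m => all2 implb m m' && copy_mask D T m) (masks (nleaves T)) =
  count (copy_mask D T') (masks (nleaves T')).
Proof.
move=> szm' rT; have sub_size m : all2 implb m m' -> size m = size m'.
  by rewrite all2E => /andP[/eqP].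
pose below := [seq m <- masks (nleaves T) | all2 implb m m'].
have below_masks : perm_eq (map (mask m') below) (masks (nleaves T')).
  apply: uniq_perm; rewrite ?uniq_masks //.
    rewrite map_inj_in_uniq ?filter_uniq ?uniq_masks // => m1 m2.
    rewrite !mem_filter => /andP[/maskK_implb E1 _] /andP[/maskK_implb E2 _] E.
    by rewrite -E1 -E2 E.
  rewrite (nleaves_restr_Some _ _ _ szm' rT) => m; rewrite mem_masks.
  apply/mapP/eqP => [[m1]|szm].
    by rewrite mem_filter => /andP[/sub_size szm1 _] ->; rewrite size_mask.
  exists (unmask m' m); last by rewrite unmaskK.
  by rewrite mem_filter mem_masks size_unmask szm' eqxx unmask_implb.
rewrite -(permP below_masks) count_map count_filter.
apply: eq_count => m /=; case mm': (all2 _ _ _); rewrite ?andbF ?andbT //=.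
by rewrite /copy_mask count_mask_implb // -(restr_comp _ _ _ szm' mm') rT.
Qed.

(** * Double counting, applied to the deletion of one leaf *)

Lemma sum_count_exchange (X Y : eqType) (r : Y -> X -> bool) (P : pred Y)
    (s : seq X) (t : seq Y) :
  \sum_(x <- s) count (fun y => r y x && P y) t =
  \sum_(y <- t | P y) count (r y) s.
Proof.
under eq_bigr do rewrite -sum1_count.
under [RHS]eq_bigr do rewrite -sum1_count big_mkcond.
rewrite [RHS]exchange_big; apply: eq_bigr => x _.
by rewrite -big_mkcondr; apply: eq_bigl => y; rewrite andbC.
Qed.

(** The masks of length [n] that omit exactly one leaf. *)
Fixpoint holes (n : nat) : seq bitseq :=
  if n is n'.+1 then (false :: nseq n' true) :: map (cons true) (holes n')
  else [::].

Lemma size_holes n : size (holes n) = n.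
Proof. by elim: n => //= n IH; rewrite size_map IH. Qed.

Lemma holesP n m : m \in holes n.+1 -> size m = n.+1 /\ count id m = n.
Proof.
elim: n m => [|n IH] m; first by rewrite inE => /eqP->.
rewrite inE => /orP[/eqP->|/mapP[m' /IH[sz ct] ->]] /=.
  by rewrite size_nseq count_nseq mul1n.
by rewrite sz ct.
Qed.

(** A set of leaves survives the deletion of a leaf exactly when that leaf lies outside it. *)
Lemma count_holes n m : size m = n -> count (all2 implb m) (holes n) = count negb m.
Proof.
move=> <-{n}; elim: m => //= b m IH; rewrite count_map.
have -> : all2 implb m (nseq (size m) true).
  by elim: m {IH} => //= c m ->; rewrite implybT.
by rewrite implybF andbT -IH; congr addn; apply: eq_count => m' /=; rewrite implybT.
Qed.

Lemma sum_holes n (P : pred bitseq) :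
  \sum_(m' <- holes n) count (fun m => all2 implb m m' && P m) (masks n) =
  \sum_(m <- masks n | P m) count negb m.
Proof.
rewrite sum_count_exchange big_seq_cond [RHS]big_seq_cond.
apply: eq_bigr => m; rewrite mem_masks => /andP[/eqP szm _].
by rewrite count_holes.
Qed.

(** Each copy survives in [n.+1 - nleaves D] of the [n.+1] deletions, and each deletion leaves a
    [d]-ary tree with [n] leaves, hence at most [B] copies. *)
Lemma copies_delete_leaf (d n B : nat) (D T : tree) :
  0 < nleaves D -> dary d T -> nleaves T = n.+1 -> 0 < n ->
  (forall T', dary d T' -> nleaves T' = n -> copies D T' <= B) ->
  copies D T * (n.+1 - nleaves D) <= n.+1 * B.
Proof.
move=> D0 dT nT n0 leB; rewrite copies_masks // nT; set N := n.+1.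
have -> : count (copy_mask D T) (masks N) * (N - nleaves D) =
    \sum_(m' <- holes N) count (fun m => all2 implb m m' && copy_mask D T m)
      (masks N).
  rewrite sum_holes -sum1_count big_distrl big_seq_cond [RHS]big_seq_cond.
  apply: eq_bigr => m; rewrite mem_masks => /and3P[/eqP szm /eqP ct _].
  by rewrite [LHS]mul1n -szm -(count_predC id) ct addKn.
rewrite -[X in _ <= X * _](size_holes N) -sum1_size big_distrl.
rewrite big_seq [leqRHS]big_seq; apply: leq_sum => m' /holesP[szm' ctm'].
rewrite [leqRHS]mul1n; have szm'T : size m' = nleaves T by rewrite nT.
case E: (restr m' T) => [T'|]; last first.
  by move: (nleaves_restr _ _ szm'T) n0; rewrite E ctm' /= => <-.
have nT' : nleaves T' = n by rewrite (nleaves_restr_Some _ _ _ szm'T E).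
rewrite /N -nT (count_copy_mask_restr _ _ _ _ szm'T E).
by rewrite -copies_masks // leB // (dary_restr _ _ _ _ dT E).
Qed.

(** * Replacing leaves by cherries *)

Fixpoint double_leaves (T : tree) : tree :=
  let: Node ts := T in
  Node (if nilp ts then [:: T; T] else map double_leaves ts).

(** The masks selecting exactly one leaf of each cherry of [double_leaves T]. *)
Definition double_mask (m : bitseq) : bitseq := flatten [seq [:: b; ~~ b] | b <- m].

Lemma nleaves_double T : nleaves (double_leaves T) = 2 * nleaves T.
Proof.
elim/tree_nested_ind: T => ts IH; case: ts IH => [//|t ts] IH.
rewrite !nleaves_Node //.
pose Q ts := sumn (map nleaves (map double_leaves ts)) = 2 * sumn (map nleaves ts).
apply: (IH Q); rewrite {}/Q //= => u us -> ->; by rewrite mulnDr.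
Qed.

Lemma dary_double d T : 2 <= d -> dary d T -> dary d (double_leaves T).
Proof.
move=> d2; elim/tree_nested_ind: T => ts IH; case: ts IH => [|t ts] IH.
  by rewrite /= d2.
rewrite /= size_map => /andP[-> /=].
pose Q ts := all (dary d) ts -> all (dary d) (map double_leaves ts).
by apply: (IH Q); rewrite {}/Q //= => u us IHu IHus /andP[/IHu -> /IHus].
Qed.

Lemma size_double_mask m : size (double_mask m) = 2 * size m.
Proof. by elim: m => //= b m IH; rewrite IH mulnS. Qed.

Lemma double_mask_cat m1 m2 :
  double_mask (m1 ++ m2) = double_mask m1 ++ double_mask m2.
Proof. by rewrite /double_mask map_cat flatten_cat. Qed.

(** Restriction suppresses unary vertices, so [T] is recovered exactly because a [d]-ary tree has
    none. *)
Lemma restr_double d T m : dary d T -> size m = nleaves T ->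
  restr (double_mask m) (double_leaves T) = Some T.
Proof.
elim/tree_nested_ind: T m => ts IH m; case: ts IH => [|t ts] IH.
  by case: m => [|[] []].
move=> dT; rewrite nleaves_Node // => szm.
rewrite [double_leaves _]/= restr_Node //.
pose Q ts := forall m, all (dary d) ts -> size m = sumn (map nleaves ts) ->
  restrs (double_mask m) (map double_leaves ts) = ts.
have restrsE : Q (t :: ts).
  apply: (IH Q); rewrite {}/Q //= => u us IHu IHus {szm}m /andP[du dus] szm.
  rewrite -[m](cat_take_drop (nleaves u)) double_mask_cat.
  have szu : size (take (nleaves u) m) = nleaves u.
    by rewrite size_takel // szm leq_addr.
  have szdu : size (double_mask (take (nleaves u) m)) = nleaves (double_leaves u).
    by rewrite size_double_mask szu nleaves_double.
  rewrite take_size_cat // drop_size_cat // IHu // IHus //.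
  by rewrite size_drop szm addKn.
move: dT => /andP[szts all_dary]; rewrite restrsE //.
by case: ts szts {IH szm Q restrsE all_dary}.
Qed.

(** Per cherry, [m] leaves two choices if it uses no leaf, one if it uses one leaf, and none if it
    uses both; the product form avoids the exponent [n - count id m]. *)
Lemma count_double_mask n m : size m = 2 * n ->
  count (fun f => all2 implb m (double_mask f)) (masks n) * 2 ^ count id m <= 2 ^ n.
Proof.
elim: n m => [|n IH] m; first by case: m.
rewrite mulnS; case: m => [|b [|c m]] //= [szm].
rewrite count_cat !count_map.
pose N := count (fun f => all2 implb m (double_mask f)) (masks n).
(* The choice [false] takes the second leaf of the first cherry, so it is possible only if [m] omits
   the first leaf, and vice versa for [true]. *)
have -> : count (preim (cons false)
    (fun f => all2 implb [:: b, c & m] (double_mask f))) (masks n) = ~~ b * N.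
  case: b => /=; last by rewrite mul1n; apply: eq_count; case: c.
  exact: count_pred0.
have -> : count (preim (cons true)
    (fun f => all2 implb [:: b, c & m] (double_mask f))) (masks n) = ~~ c * N.
  case: c => /=; last by rewrite mul1n; apply: eq_count; case: b.
  by rewrite (eq_count (a2 := pred0)) ?count_pred0 //; case: b.
move: (IH _ szm); rewrite -/N expnS !expnD; set k := 2 ^ count id m.
by case: b; case: c; rewrite /= ?expn1 ?expn0; lia.
Qed.

(** Pairs of a choice and a copy inside it are counted twice: every choice contributes [copies D T],
    and [count_double_mask] bounds the choices around a given copy. *)
Lemma copies_double d D T : 0 < nleaves D -> dary d T ->
  2 ^ nleaves D * copies D T <= copies D (double_leaves T).
Proof.
move=> D0 dT; rewrite !copies_masks //.
set n := nleaves T.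
have n20 : 0 < 2 ^ n by rewrite expn_gt0.
rewrite -(leq_pmul2l n20).
have -> : 2 ^ n * (2 ^ nleaves D * count (copy_mask D T) (masks n)) =
    (\sum_(f <- masks n) count (fun m => all2 implb m (double_mask f) &&
      copy_mask D (double_leaves T) m) (masks (nleaves (double_leaves T)))) *
    2 ^ nleaves D.
  rewrite mulnCA [LHS]mulnC; congr (_ * _).
  rewrite -[X in X * _](size_masks n) -sum1_size big_distrl /=.
  apply: eq_big_seq => f; rewrite mem_masks => /eqP szf.
  rewrite mul1n (count_copy_mask_restr _ _ T) ?(restr_double _ _ _ dT) //.
  by rewrite nleaves_double size_double_mask szf.
rewrite sum_count_exchange -sum1_count big_distrr big_distrl /=.
rewrite big_seq_cond [leqRHS]big_seq_cond; apply: leq_sum => m.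
rewrite mem_masks nleaves_double => /andP[/eqP szm /andP[/eqP <- _]].
by rewrite muln1 count_double_mask.
Qed.

Lemma leq_copies_bin D T : copies D T <= 'C(nleaves T, nleaves D).
Proof.
rewrite -card_leaf -card_draws; apply/subset_leq_card/fintype.subsetP => S.
by rewrite !inE => /andP[].
Qed.

Lemma iter_double d D T j : 2 <= d -> 0 < nleaves D -> dary d T ->
  [/\ dary d (iter j double_leaves T),
      nleaves (iter j double_leaves T) = 2 ^ j * nleaves T
    & (2 ^ j) ^ nleaves D * copies D T <= copies D (iter j double_leaves T)].
Proof.
move=> d2 D0 dT; elim: j => [|j [dj nj cj]]; first by rewrite expn0 exp1n !mul1n.
split; first exact: dary_double.
  by rewrite iterS nleaves_double nj mulnA -expnS.
rewrite iterS expnS expnMn -mulnA; apply: leq_trans (copies_double _ _ _ D0 dj).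
by rewrite leq_mul2l cj orbT.
Qed.

(** Division-free form of [n ^_ k / n ^ k >= 1 - k ^ 2 / n]; the induction works because
    [k ^ 2 + k <= k.+1 ^ 2]. *)
Lemma expn_leq_ffact n k : k <= n -> n * n ^ k <= n * n ^_ k + k ^ 2 * n ^ k.
Proof.
elim: k => [|k IH] kn; first by rewrite mul0n addn0 ffactn0 expn0.
have := IH (ltnW kn); rewrite ffactnSr (expnS n).
set A := n ^ k; set B := n ^_ k => leAB.
have [m nE] : exists m, n = k + m by exists (n - k); rewrite subnKC // ltnW.
have -> : n - k = m by rewrite nE addKn.
have mA_le : m * A <= n * A by rewrite leq_mul2r nE leq_addl orbT.
have := leq_mul (leqnn m) leAB; have := leq_mul (leqnn (k * k)) mA_le.
have -> : n * (n * A) = k * (n * A) + m * (n * A) by rewrite -mulnDl -nE.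
by move: (n * A); rewrite !expnS !expn0; lia.
Qed.

Local Open Scope classical_set_scope.
Local Open Scope ring_scope.

(** * Maximal densities: monotonicity, comparison along doublings, and the limit *)

Lemma density_ge0 (R : realType) D T : 0 <= density R D T.
Proof. by rewrite /density divr_ge0 ?ler0n. Qed.

Lemma density_le1 (R : realType) D T : density R D T <= 1.
Proof.
rewrite /density; have := leq_copies_bin D T.
case: 'C(_, _) => [|b cb]; first by rewrite invr0 mulr0.
by rewrite ler_pdivrMr ?ltr0n // mul1r ler_nat.
Qed.

Lemma density_le_max (R : realType) d D T : (2 <= d)%N -> (0 < nleaves T)%N ->
  dary d T -> density R D T <= max_density R d D (nleaves T).
Proof.
by move=> d2 T0 dT; have [T' _ [<- ->]] := max_density_attained R D d2 T0.
Qed.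

Lemma max_densityS (R : realType) d D n : (2 <= d)%N -> (0 < nleaves D)%N ->
  (nleaves D <= n)%N -> max_density R d D n.+1 <= max_density R d D n.
Proof.
move=> d2 D0 Dn; have n0 := leq_trans D0 Dn.
have [T [dT nT] [<- _]] := max_density_attained R D d2 (ltn0Sn n).
have [T' [dT' nT'] [<- maxT']] := max_density_attained R D d2 n0.
have Cn0 : (0 < 'C(n, nleaves D))%N by rewrite bin_gt0.
have CS0 : (0 < 'C(n.+1, nleaves D))%N by rewrite bin_gt0 leqW.
have leT' T'' : dary d T'' -> nleaves T'' = n -> (copies D T'' <= copies D T')%N.
  move=> dT'' nT''; have := maxT' _ dT'' nT''.
  by rewrite /density nT'' nT' ler_pM2r ?invr_gt0 ?ltr0n // ler_nat.
have := copies_delete_leaf _ _ _ _ _ D0 dT nT n0 leT'.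
rewrite /density nT nT' ler_pdivrMr ?ltr0n // mulrAC ler_pdivlMr ?ltr0n //.
rewrite -!natrM ler_nat => leTT'.
(* With [k = nleaves D], the identity [n.+1 * 'C(n, k) = (n.+1 - k) * 'C(n.+1, k)] brings in the
   factor of [copies_delete_leaf]. *)
rewrite -(leq_pmul2l (ltn0Sn n)) [leqLHS]mulnCA (mul_bin_down n.+1).
by rewrite !mulnA leq_mul2r leTT' orbT.
Qed.

Lemma max_density_double (R : realType) d D n j : (2 <= d)%N ->
  (0 < nleaves D)%N -> (nleaves D <= n)%N ->
  max_density R d D n - (nleaves D ^ 2)%:R / n%:R <= max_density R d D (2 ^ j * n).
Proof.
move=> d2 D0 Dn; have n0 := leq_trans D0 Dn.
have [T [dT nT] [<- _]] := max_density_attained R D d2 n0.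
have [dj nj cj] := iter_double _ _ _ j d2 D0 dT.
set Tj := iter j double_leaves T in dj nj cj.
have N0 : (0 < nleaves Tj)%N by rewrite nj nT muln_gt0 expn_gt0 n0.
rewrite -nT -nj; apply: le_trans (density_le_max R _ D _ d2 N0 dj).
set k := nleaves D in D0 Dn cj *.
have := density_le1 R D T; have := density_ge0 R D T.
rewrite /density nj nT -/k; set c := copies D T in cj *; set C := copies D Tj in cj *.
have BN0 : (0 < 'C(2 ^ j * n, k))%N.
  by rewrite bin_gt0 (leq_trans Dn) // leq_pmull // expn_gt0.
have leB : ('C(2 ^ j * n, k) * k`! <= (2 ^ j) ^ k * n ^ k)%N.
  rewrite bin_ffact -expnMn ffact_prod -[X in (_ <= _ ^ X)%N]card_ord.
  by rewrite -prod_nat_const leq_prod // => i _; exact: leq_subr.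
have Bn0 : (0 < 'C(n, k))%N by rewrite bin_gt0.
have := expn_leq_ffact n k Dn; move: (k ^ 2)%N => K leA.
set x := c%:R / _; move=> x0 x1.
have cE : (c%:R : R) = x * 'C(n, k)%:R by rewrite /x divfK // pnatr_eq0 -lt0n.
have A0 : (0 < n ^ k)%N by rewrite expn_gt0 n0.
have n0R : 0 < (n%:R : R) by rewrite ltr0n.
(* The first inequality turns the relative error [K / n] into an absolute one by [x <= 1]; the
   second combines [cj] with [leB], where the powers of [2 ^ j] cancel. *)
apply: (@le_trans _ _ (x * (n ^_ k)%:R / (n ^ k)%:R)).
  rewrite ler_pdivlMr ?ltr0n // -(ler_pM2l n0R).
  move: leA; rewrite -(ler_nat R) !natrD !natrM.
  move: A0; rewrite -(ltr0n R).
  move: ((n ^ k)%:R) ((n ^_ k)%:R) (K%:R : R) (ler0n R K) => A F {}K K0 A0 leA.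
  have -> : n%:R * ((x - K / n%:R) * A) = x * (n%:R * A) - K * A.
    by field; rewrite gt_eqF.
  have := ler_wpM2l x0 leA.
  have : 0 <= (1 - x) * (K * A) by rewrite !mulr_ge0 ?subr_ge0 // ltW.
  by lra.
rewrite ler_pdivrMr ?ltr0n // [X in _ <= X]mulrAC ler_pdivlMr ?ltr0n //.
rewrite -bin_ffact natrM mulrA -cE -!natrM ler_nat.
have := leq_mul (leqnn c) leB; have := leq_mul cj (leqnn (n ^ k)); lia.
Qed.

Theorem theorem3 (R : realType) (d : nat) (D : tree)
    (hd : (2 <= d)%N) (hD : dary d D) (hD2 : (2 <= nleaves D)%N) :
  [/\ exists K : R, forall n : nat, (nleaves D <= n)%N ->
        `|max_density R d D n - inducibility R d D| <= K / n%:R,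
      max_density R d D n @[n --> \oo] --> inducibility R d D
    & forall m n : nat, (nleaves D <= m)%N -> (m <= n)%N ->
        max_density R d D n <= max_density R d D m].
Proof.
have D0 : (0 < nleaves D)%N by exact: ltnW.
have M_decr m n : (nleaves D <= m)%N -> (m <= n)%N ->
    max_density R d D n <= max_density R d D m.
  move=> Dm /subnK<-; elim: (n - m)%N => // i; apply: le_trans.
  by rewrite addSn max_densityS // (leq_trans Dm) // leq_addl.
have M_ge0 n : (0 < n)%N -> 0 <= max_density R d D n.
  move=> n0; have [T _ [<- _]] := max_density_attained R D hd n0.
  exact: density_ge0.
(* Monotonicity holds only from [nleaves D] on, hence the shift. *)
pose u n := max_density R d D (n + nleaves D).
have u_decr : nonincreasing_seq u.
  by move=> m n mn; apply: M_decr; rewrite ?leq_addl ?leq_add2r.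
have u_cvg : cvgn u.
  apply: nonincreasing_is_cvgn => //; exists 0 => _ [n _ <-].
  by rewrite M_ge0 // addn_gt0 D0 orbT.
have M_cvg : max_density R d D n @[n --> \oo] --> limn u.
  by rewrite -(cvg_shiftn (nleaves D)).
have -> : inducibility R d D = limn u.
  by rewrite /inducibility (cvg_limn_inf_sup M_cvg).2.
split=> //; exists (nleaves D ^ 2)%:R => n Dn.
have I_le : limn u <= max_density R d D n.
  by rewrite -(subnK Dn); exact: nonincreasing_cvgn_ge.
rewrite ger0_norm ?subr_ge0 // lerBlDr -lerBlDl.
apply: limr_ge => //; near=> i.
(* Doubling [i + nleaves D] times gives at least [i + nleaves D] leaves, so monotonicity compares
   the result with [u i]. *)
apply: le_trans (max_density_double R d D n (i + nleaves D) hd D0 Dn) _.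
apply: M_decr; rewrite ?leq_addl // (leq_trans (ltnW (ltn_expl _ (ltnSn 1)))) //.
by rewrite leq_pmulr // (leq_trans D0).
Unshelve. all: by end_near.
Qed.
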